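(* Let $(N,M,V,G)$ be a problem instance with $n=|N|>\Delta(G)$ in which all agents have the same valuation function $v$, with item values in $[0,1]$ (i.e., $v:M\to[0,1]$, extended additively), and let $W=v(M)>0$. Then for any $c>\sqrt{8}$ there exists an $\alpha$-approximate proportional allocation with $$\alpha\ge 1-\frac{1}{e}-c\,n\sqrt{\frac{\ln n}{W}}.$$
   Context: A problem instance is a quadruple $(N,M,V,G)$, where $N$ is a finite set of $n$ agents, $M$ is a finite set of $m$ items, $V$ is a family of additive valuation functions $v_i:2^M\to\mathbb{R}_{\ge 0}$, $i\in N$, and $G=(M,E)$ is an undirected (simple) conflict graph on the items. An allocation is an ordered partition $A=\langle A_i\rangle_{i\in N}$ of all of $M$ into $|N|$ (possibly empty) bundles; it is feasible if every bundle is an independent set of $G$. A feasible allocation $A$ is $\alpha$-approximate proportional if $v_i(A_i)\ge\alpha\,v_i(M)/|N|$ for every $i\in N$. $\Delta(G)$ is the maximum degree of $G$. *)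

(* Defs.v *)
From mathcomp Require Import all_boot all_order all_algebra.
From mathcomp Require Import reals.

Set Implicit Arguments.
Unset Strict Implicit.
Unset Printing Implicit Defensive.
Import Order.TTheory GRing.Theory Num.Theory.

Local Open Scope ring_scope.

Record simple_graph (M : finType) := SimpleGraph {
  edge : rel M;
  edge_sym : symmetric edge;
  edge_irr : irreflexive edge
}.

Section Graph.
Variables (M : finType) (G : simple_graph M).

Definition degree (x : M) : nat := #|[set y | edge G x y]|.

Definition max_degree : nat := \max_(x : M) degree x.

Definition independent (S : {set M}) : Prop :=
  forall x y, x \in S -> y \in S -> ~~ edge G x y.
End Graph.

Definition additive_valuation (R : realType) (M : finType)
    (v : {set M} -> R) : Prop :=
  forall S : {set M}, v S = \sum_(x in S) v [set x].

Record instance (R : realType) := Instance {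
  agents : finType;
  items : finType;
  valuation : agents -> {set items} -> R;
  conflict : simple_graph items;
  valuation_ge0 : forall i S, 0 <= valuation i S;
  valuation_additive : forall i, additive_valuation (valuation i)
}.

Section Allocation.
Variables (R : realType) (P : instance R).

(* Bundles may be empty, so this is not [finset.partition], which excludes
   empty blocks and forgets which agent owns a block. *)
Definition is_allocation (A : {ffun agents P -> {set items P}}) : Prop :=
  (forall i j, i != j -> [disjoint A i & A j]) /\
  \bigcup_(i : agents P) A i = [set: items P].

Definition feasible (A : {ffun agents P -> {set items P}}) : Prop :=
  is_allocation A /\ forall i, independent (conflict P) (A i).

Definition approx_proportional (alpha : R)
    (A : {ffun agents P -> {set items P}}) : Prop :=
  feasible A /\
  forall i, valuation i (A i) >=
            alpha * valuation i [set: items P] / #|agents P|%:R.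
End Allocation.

(* Main.v *)
(* Fix an order of the items and let every item pick one of the n colours
   uniformly at random, keeping it unless an earlier neighbour picked the same
   one.  An item with d earlier neighbours keeps its colour with probability
   (1 - 1/n)^d; in a random order d is uniform on 0..deg, so some order gives
   every colour expected value at least (1 - 1/e) W/n.  Conditioning on the picks
   one item at a time, one pick moves the conditional expectation of a colour by
   at most its influence, and the influences sum to at most 2W; an exponential
   potential, derandomised by averaging over the n choices, gives picks for which
   all colours are simultaneously close to their expectation.  The uncoloured
   items are then coloured greedily, since n exceeds the maximum degree. *)
Require Import Defs.
From mathcomp Require Import all_boot all_order all_algebra.
From mathcomp Require Import reals sequences exp.
From mathcomp Require Import ring lra.

Set Implicit Arguments.
Unset Strict Implicit.
Unset Printing Implicit Defensive.
Import Order.TTheory GRing.Theory Num.Theory.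

Local Open Scope ring_scope.

(** * Averaging and elementary inequalities *)

Lemma exists_ge_average (R : realType) (T : finType) (S : {set T}) (F : T -> R)
    (a : R) :
  S != set0 -> #|S|%:R * a <= \sum_(x in S) F x ->
  exists2 x, x \in S & a <= F x.
Proof.
move=> /set0Pn [x0 Sx0] le_sum.
have [/exists_inP [x Sx le_aF]|none] := boolP [exists x in S, a <= F x].
  by exists x.
have ltF x : x \in S -> F x < a.
  move=> Sx; rewrite ltNge; apply: contra none => le_aF.
  by apply/exists_inP; exists x.
have: \sum_(x in S) F x < \sum_(x in S) a.
  rewrite (bigD1 x0) //= [ltRHS](bigD1 x0) //=.
  by rewrite ltr_leD ?ltF// ler_sum// => x /andP [Sx _]; rewrite ltW ?ltF.
by rewrite sumr_const -mulr_natl ltNge le_sum.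
Qed.

(** Multiplying the right side by [1 - y <= expR (- y)] gives [1 + y ^+ 2 * (1 - 2 * y)], which is
    at least 1. *)
Lemma expR_le_quadratic (R : realType) (y : R) :
  y <= 2^-1 -> expR y <= 1 + y + 2 * y ^+ 2.
Proof.
move=> le_y.
have ge0 : 0 <= 1 + y + 2 * y ^+ 2.
  by have := sqr_ge0 (y + 1); have := sqr_ge0 y; nra.
have := expR_ge1Dx (- y); rewrite expRN => le_inv.
have e0 := expR_gt0 y.
rewrite -(ler_pM2r (_ : 0 < (expR y)^-1)) ?invr_gt0// divff ?gt_eqF//.
apply: le_trans (ler_wpM2l ge0 le_inv).
have : 0 <= y ^+ 2 * (1 - 2 * y) by rewrite mulr_ge0 ?sqr_ge0//; lra.
by rewrite !expr2; lra.
Qed.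

(* The mean of geometric terms that a vertex of degree [d] gets in a uniformly
   random order, where its number of earlier neighbours is uniform on 0..d. *)
Definition geometric_mean (R : realType) (q : R) (d : nat) : R :=
  (\sum_(k < d.+1) q ^+ k) / d.+1%:R.

(** In a random order of a vertex and its [d] neighbours, either the vertex comes last, or a
    neighbour does and the degree drops by one. For [d = 0] the truncated [d.-1] carries the factor
    0. *)
Lemma geometric_mean_succ (R : realType) (q : R) d :
  q ^+ d + d%:R * geometric_mean q d.-1 = d.+1%:R * geometric_mean q d.
Proof.
rewrite /geometric_mean.
case: d => [|d]; first by rewrite big_ord1 mul0r addr0 divr1 mul1r.
by rewrite ![_%:R * _]mulrC !divfK ?pnatr_eq0// [RHS]big_ord_recr /= addrC.
Qed.

(** The powers of [q] do not increase, so appending further terms cannot raise the mean. *)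
Lemma geometric_mean_ge (R : realType) (q : R) (d n : nat) :
  0 <= q <= 1 -> (d < n)%N ->
  (\sum_(k < n) q ^+ k) / n%:R <= geometric_mean q d.
Proof.
move=> /andP [q0 q1] ltdn.
rewrite -(subnK ltdn) addnC; elim: (n - d.+1)%N => [|m IHm].
  by rewrite addn0.
apply: le_trans IHm; rewrite addnS big_ord_recr /=.
set k := (d.+1 + m)%N.
have k0 : (0 < k)%N by rewrite /k.
rewrite ler_pdivrMr ?ltr0n// mulrAC ler_pdivlMr ?ltr0n//.
have : k%:R * q ^+ k <= \sum_(i < k) q ^+ i.
  rewrite mulr_natl -[k in _ *+ k]card_ord -sumr_const.
  by apply: ler_sum => i _; rewrite ler_wiXn2l// ltnW.
by rewrite -natr1; lra.
Qed.

(** * Partial colourings and their greedy completion *)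

Section Coloring.
Variables (M I : finType) (G : simple_graph M).

Definition neighbors (x : M) : {set M} := [set y | edge G x y].

Definition proper_coloring (f : M -> option I) : Prop :=
  forall x y i, edge G x y -> f x = Some i -> f y <> Some i.

Lemma card_neighbors x : (#|neighbors x| <= max_degree G)%N.
Proof. exact: (@leq_bigmax_cond _ predT (degree G)). Qed.

(** Induction on the number of uncoloured vertices: a vertex has fewer neighbours than there are
    colours, so some colour is free for it. *)
Lemma proper_coloring_extend (f : M -> option I) :
  (max_degree G < #|I|)%N -> proper_coloring f ->
  exists h : M -> I,
    (forall x i, f x = Some i -> h x = i) /\
    (forall x y, edge G x y -> h x != h y).
Proof.
move=> ltGI.
have [m] := ubnP #|[set x | f x == None]|; elim: m f => // m IHm f le_m pf.
have [none0 | [z]] := set_0Vmem [set x | f x == None].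
  have fS x : exists i, f x == Some i.
    have /setP/(_ x) := none0; rewrite !inE; case: (f x) => // i _.
    by exists i.
  have [h fh] : exists h, forall x, f x = Some (h x).
    by exists (fun x => xchoose (fS x)) => x; apply/eqP/(xchooseP (fS x)).
  exists h; split => [x i|x y xy]; first by rewrite fh => -[].
  by apply/eqP => exy; apply: (pf x y _ xy (fh x)); rewrite fh exy.
rewrite inE => /eqP fz.
have [i fNi] : exists i, forall y, edge G z y -> f y <> Some i.
  have /subsetPn [o /imsetP [i _ ->] Ni] :
      ~~ (Some @: [set: I] \subset f @: neighbors z).
    apply: contraL ltGI => /subset_leq_card.
    rewrite card_imset ?cardsT; last by move=> ? ? [].
    move=> le; rewrite -leqNgt (leq_trans le)//.
    exact: leq_trans (leq_imset_card _ _) (card_neighbors z).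
  exists i => y zy fy; move/negP: Ni; apply.
  by apply/imsetP; exists y; rewrite ?inE.
pose f' x := if x == z then Some i else f x.
have [||h [hf hp]] := IHm f'.
- rewrite ltnS in le_m; apply: leq_trans le_m; apply: proper_card.
  apply/properP; split.
    by apply/subsetP => x; rewrite !inE /f'; case: (x == z).
  by exists z; rewrite !inE ?fz // /f' eqxx.
- move=> x y j xy; rewrite /f'; case: (eqVneq x z) xy => [->|_] xy.
    move=> [<-]; case: (eqVneq y z) xy => [->|_]; first by rewrite edge_irr.
    exact: fNi.
  case: (eqVneq y z) xy => [->|_] xy; last exact: pf xy.
  by move=> fx [ij]; subst j; apply: (fNi x); rewrite // edge_sym.
exists h; split=> // x j fx; apply: hf; rewrite /f'.
by case: eqP fx => // ->; rewrite fz.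
Qed.
End Coloring.

(** * One colour under sequential random picks *)

Section SequentialColoring.
Variables (R : realType) (M : finType) (G : simple_graph M) (v : M -> R).
Variables (p : R).
Hypotheses (p01 : 0 <= p <= 1) (v01 : forall x, 0 <= v x <= 1).
Let q := 1 - p.

(* Expected value of one fixed colour when the vertices of [s] pick that colour
   independently with probability [p] and keep it unless they lie in [K] or an
   earlier neighbour has picked it. *)
Fixpoint mean_kept (K : {set M}) (s : seq M) : R :=
  if s is x :: s' then
    p * ((if x \in K then 0 else v x) + mean_kept (K :|: neighbors G x) s')
    + q * mean_kept K s'
  else 0.

(** Coming last, [z] affects no other vertex, and it keeps its pick when no earlier neighbour made
    the same one. *)
Lemma mean_kept_rcons (K : {set M}) (s : seq M) z :
  mean_kept K (rcons s z) = mean_kept K s +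
    p * (if z \in K then 0 else v z * q ^+ count (edge G z) s).
Proof.
elim: s K => [|x s IHs] K /=.
  by case: ifP => _; rewrite ?expr0; ring.
rewrite !IHs inE [z \in neighbors G x]inE edge_sym.
case: (z \in K) => /=; first by ring.
case: (edge G z x) => /=; rewrite ?add1n ?add0n ?exprS /q; ring.
Qed.

(** The order is built from its end: averaged over the choice of the last vertex, its own share plus
    the bound for the rest equals the bound for [S]. *)
Lemma exists_good_order (S : {set M}) :
  exists s : seq M, [/\ uniq s, s =i S &
    p * \sum_(x in S) v x * geometric_mean q #|neighbors G x :&: S|
      <= mean_kept set0 s].
Proof.
have [m] := ubnP #|S|; elim: m S => // m IHm S le_m.
have [->|Sn0] := eqVneq S set0.
  by exists [::]; split => // [x|]; rewrite ?inE// big_set0 mulr0.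
pose g x (U : {set M}) := geometric_mean q #|neighbors G x :&: U|.
pose F z := v z * q ^+ #|neighbors G z :&: S|
            + \sum_(x in S :\ z) v x * g x (S :\ z).
(* The coefficient of [v x] summed over all last vertices: removing a neighbour of [x] lowers its
   degree, removing any other vertex does not. *)
have sum_g x : x \in S ->
    q ^+ #|neighbors G x :&: S| + \sum_(z in S :\ x) g x (S :\ z)
    = #|S|%:R * g x S.
  move=> Sx; set d := #|_|.
  have Nx : neighbors G x :&: S = neighbors G x :&: (S :\ x).
    apply/setP => y; rewrite !inE.
    by case: eqP => [->|]; rewrite ?edge_irr.
  rewrite (big_setID (neighbors G x)) /= addrA.
  rewrite (eq_bigr (fun=> geometric_mean q d.-1)); last first.
    move=> z; rewrite !inE => /andP [/andP [_ Sz] xz].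
    by rewrite /g setIDA /d [in RHS](cardsD1 z) !inE xz Sz add1n.
  rewrite sumr_const setIC -Nx -/d -[_ *+ d]mulr_natl geometric_mean_succ.
  rewrite (eq_bigr (fun=> geometric_mean q d)); last first.
    move=> z; rewrite !inE => /andP [nxz _].
    by rewrite /g /d setIDA [in RHS](cardsD1 z) !inE (negbTE nxz) add0n.
  rewrite sumr_const -[geometric_mean _ _ *+ _]mulr_natl.
  rewrite -mulrDl -natrD; congr (_%:R * _).
  rewrite [RHS](cardsD1 x) Sx add1n addSn; congr _.+1.
  by rewrite -(cardsID (neighbors G x) (S :\ x)) setIC -Nx.
have [|z Sz le_z] := @exists_ge_average R M S F (\sum_(x in S) v x * g x S) Sn0.
  rewrite big_split /= mulr_sumr.
  rewrite [X in _ <= _ + X](exchange_big_dep (mem S)) /=; last first.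
    by move=> z x _; rewrite !inE => /andP [].
  rewrite -big_split /=; rewrite le_eqVlt; apply/orP; left; apply/eqP.
  apply: eq_bigr => x Sx.
  rewrite mulrCA -(sum_g x Sx) mulrDr mulr_sumr; congr (_ + _).
  by apply: eq_bigl => z; rewrite !inE Sx andbT eq_sym andbC.
have [|s [us sS le_s]] := IHm (S :\ z).
  by move: le_m; rewrite (cardsD1 z S) Sz.
exists (rcons s z); split.
- by rewrite rcons_uniq us sS !inE eqxx.
- by move=> x; rewrite mem_rcons !inE sS !inE; case: eqP => [->|].
rewrite mean_kept_rcons in_set0.
have -> : count (edge G z) s = #|neighbors G z :&: S|.
  rewrite -size_filter -(card_uniqP _) ?filter_uniq//; apply: eq_card => y.
  rewrite mem_filter !inE sS !inE.
  by case: eqP => [->|]; rewrite ?edge_irr.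
have /andP [p0 _] := p01.
apply: le_trans (ler_wpM2l p0 le_z) _.
by rewrite /F mulrDr addrC lerD2r.
Qed.

(** A vertex picks the colour with probability [p], so blocking it on [U] costs at most [p * v y]
    for each [y] of [U] still to come. *)
Lemma mean_kept_kill (K U : {set M}) (s : seq M) : uniq s ->
  mean_kept (K :|: U) s <= mean_kept K s /\
  mean_kept K s <= mean_kept (K :|: U) s + p * \sum_(y in U | y \in s) v y.
Proof.
have /andP [p0 p1] := p01.
elim: s K => [|x s IHs] K /=.
  by rewrite big_pred0 ?mulr0 ?addr0// => y; rewrite andbF.
move=> /andP [xs us].
have [l0 u0] := IHs K us.
have [l1 u1] := IHs (K :|: neighbors G x) us.
have /andP [v0 _] := v01 x.
have q0 : 0 <= q by rewrite /q; lra.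
have -> : K :|: U :|: neighbors G x = K :|: neighbors G x :|: U.
  by rewrite setUAC.
have sumE : \sum_(y in U | y \in x :: s) v y =
    (if x \in U then v x else 0) + \sum_(y in U | y \in s) v y.
  have [Ux|nUx] := boolP (x \in U).
    rewrite (bigD1 x) /=; last by rewrite Ux mem_head.
    congr (_ + _); apply: eq_bigl => y; rewrite inE.
    by have [->|] := eqVneq y x; rewrite ?(negbTE xs) ?andbF ?andbT.
  rewrite add0r; apply: eq_bigl => y; rewrite inE.
  by have [->|] := eqVneq y x; rewrite ?(negbTE nUx).
rewrite sumE inE; set T := \sum_(_ in U | _) _ in u0 u1 *.
set a := mean_kept K s in l0 u0 *; set b := mean_kept (K :|: U) s in l0 u0 *.
set a' := mean_kept (K :|: _) s in l1 u1 *.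
set b' := mean_kept (_ :|: U) s in l1 u1 *.
have Hl : p * b' + q * b <= p * a' + q * a by rewrite lerD// ler_wpM2l.
have Hu : p * a' + q * a <= p * b' + q * b + p * T.
  have := lerD (ler_wpM2l p0 u1) (ler_wpM2l q0 u0).
  by rewrite /q; lra.
have pv : 0 <= p * v x by rewrite mulr_ge0.
by case: (x \in K); case: (x \in U) => /=; split; rewrite ?mulrDr; lra.
Qed.

(* Bounds the square of the gap between the conditional expectations of one
   colour's value when [x] picks that colour and when it does not. *)
Definition influence x : R := v x + p * \sum_(y in neighbors G x) v y.

(** Double counting: [v y] is collected once per neighbour of [y], so its total factor is [p] times
    a degree, at most 1. *)
Lemma sum_influence : p * (max_degree G)%:R <= 1 ->
  \sum_x influence x <= 2 * \sum_x v x.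
Proof.
move=> pD; have /andP [p0 _] := p01.
rewrite big_split /= mulr_natl mulr2n lerD2l -mulr_sumr.
rewrite (exchange_big_dep predT) //= mulr_sumr; apply: ler_sum => y _.
have -> : \sum_(x | y \in neighbors G x) v y = #|neighbors G y|%:R * v y.
  rewrite mulr_natl -sumr_const; apply: eq_bigl => x.
  by rewrite !inE edge_sym.
rewrite mulrA -[leRHS]mul1r ler_wpM2r //; first by have /andP [] := v01 y.
by apply: le_trans pD; rewrite ler_wpM2l// ler_nat card_neighbors.
Qed.

(** Exponential moment of a two-valued variable about its mean: the linear terms cancel, and the
    quadratic term is at most [l ^+ 2] times the squared gap. *)
Lemma mean_kept_exp_step (K : {set M}) x s (l : R) :
  uniq s -> p * (max_degree G)%:R <= 1 -> 2 * p <= 1 -> 0 <= l <= 2^-1 ->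
  p * expR (- l * ((if x \in K then 0 else v x)
                   + mean_kept (K :|: neighbors G x) s))
  + q * expR (- l * mean_kept K s)
  <= expR (- l * mean_kept K (x :: s) + l ^+ 2 * influence x).
Proof.
move=> us pD p2 /andP [l0 l2] /=; have /andP [p0 p1] := p01.
have [v0 v1] := andP (v01 x).
have [lo up] := mean_kept_kill K (neighbors G x) us.
set a := if _ then _ else _.
set E1 := mean_kept (_ :|: _) s in lo up *; set E0 := mean_kept K s in lo up *.
set u := p * \sum_(y in neighbors G x) v y.
have u0 : 0 <= u.
  by rewrite mulr_ge0// sumr_ge0// => y _; have /andP [] := v01 y.
have u1 : u <= 1.
  apply: le_trans pD; rewrite ler_wpM2l//.
  apply: (@le_trans _ _ #|neighbors G x|%:R); last first.
    by rewrite ler_nat card_neighbors.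
  by rewrite -sumr_const; apply: ler_sum => y _; have /andP [] := v01 y.
have upu : E0 <= E1 + u.
  apply: le_trans up _; rewrite lerD2l ler_wpM2l//.
  rewrite [leRHS](bigID (mem s)) /= lerDl sumr_ge0// => y _.
  by have /andP [] := v01 y.
have a01 : 0 <= a <= v x by rewrite /a; case: ifP; rewrite ?lexx ?v0.
have [a0 av] := andP a01.
set D := a + E1 - E0.
have D1 : -1 <= D <= 1 by rewrite /D; apply/andP; split; lra.
(* As the gap is at most 1 in absolute value, its square is at most [v x] when it is nonnegative and
   at most [u] otherwise. *)
have D2 : D ^+ 2 <= v x + u.
  have [D0|D0] := leP 0 D.
    have : D ^+ 2 <= D by rewrite expr2 ler_piMl//; lra.
    by rewrite /D in D0 *; lra.
  have : D ^+ 2 <= - D by rewrite -sqrrN expr2 ler_piMl//; lra.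
  by rewrite /D in D0 *; lra.
set E := p * (a + E1) + q * E0.
have -> : - l * (a + E1) = - l * E + - l * q * D by rewrite /E /D /q; ring.
have -> : - l * E0 = - l * E + l * p * D by rewrite /E /D /q; ring.
rewrite !expRD mulrCA [q * _]mulrCA -mulrDr ler_pM2l ?expR_gt0//.
apply: le_trans (expR_ge1Dx _).
have [D1a D1b] := andP D1.
have q01 : 0 <= q <= 1 by rewrite /q; lra.
have [q0 q1] := andP q01.
have lq : 0 <= l * q <= 2^-1 by rewrite mulr_ge0//= (le_trans _ l2)// ler_piMr.
have lp : 0 <= l * p <= 2^-1 by rewrite mulr_ge0//= (le_trans _ l2)// ler_piMr.
have h1 : expR (- l * q * D) <= 1 + - l * q * D + 2 * (- l * q * D) ^+ 2.
  apply: expR_le_quadratic; nra.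
have h2 : expR (l * p * D) <= 1 + l * p * D + 2 * (l * p * D) ^+ 2.
  apply: expR_le_quadratic; nra.
have := lerD (ler_wpM2l p0 h1) (ler_wpM2l q0 h2).
move/le_trans; apply.
have -> : p * (1 + - l * q * D + 2 * (- l * q * D) ^+ 2)
   + q * (1 + l * p * D + 2 * (l * p * D) ^+ 2)
   = 1 + (2 * p) * q * (l ^+ 2 * D ^+ 2) by rewrite /q; ring.
rewrite lerD2l.
apply: (@le_trans _ _ (l ^+ 2 * D ^+ 2)).
  (* Here [2 * p <= 1] absorbs the constant of the quadratic bound on [expR]. *)
  have pq : 2 * p * q <= 1 by apply: mulr_ile1 => //; rewrite mulr_ge0.
  by rewrite ler_piMl// mulr_ge0 ?sqr_ge0.
by rewrite ler_wpM2l ?sqr_ge0.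
Qed.
End SequentialColoring.

(** * Derandomising the picks of all colours at once *)

(** Method of conditional expectations. [K i] holds the vertices blocked for colour [i], and [w i]
    the exponential factor of the value it has already gained; both change along the induction on
    [s]. *)
Lemma exists_partial_coloring (R : realType) (M I : finType)
    (G : simple_graph M) (v : M -> R) (l : R) (s : seq M)
    (K : I -> {set M}) (w : I -> R) :
  let p : R := #|I|%:R^-1 in
  (1 < #|I|)%N -> (max_degree G < #|I|)%N -> (forall x, 0 <= v x <= 1) ->
  0 <= l <= 2^-1 -> uniq s -> (forall i, 0 <= w i) ->
  exists f : M -> option I,
    [/\ proper_coloring G f,
        forall y i, f y = Some i -> y \in s /\ y \notin K i &
        \sum_i w i * expR (- l * \sum_(y | f y == Some i) v y)
        <= \sum_i w i * expR (- l * mean_kept G v p (K i) s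
                              + l ^+ 2 * \sum_(x <- s) influence G v p x)].
Proof.
move=> p I1 ltG v01 l01.
have n0 : 0 < #|I|%:R :> R by rewrite ltr0n ltnW.
have p01 : 0 <= p <= 1.
  by rewrite invr_ge0 ltW//= invf_le1// ler1n ltnW.
have pD : p * (max_degree G)%:R <= 1.
  by rewrite mulrC ler_pdivrMr// mul1r ler_nat ltnW.
have p2 : 2 * p <= 1 by rewrite ler_pdivrMr// mul1r ler_nat.
elim: s K w => [|x s IHs] K w us w0.
  exists (fun=> None); split => //; apply: ler_sum => i _.
  by rewrite big_nil big_pred0 //= !mulr0 addr0.
have /andP [xs us'] := us.
pose B := \sum_(y <- s) influence G v p y.
pose Kx i : {set M} := K i :|: neighbors G x.
pose a i := if x \in K i then 0 else v x.
pose yes i := w i * expR (- l * (a i + mean_kept G v p (Kx i) s) + l ^+ 2 * B).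
pose no i := w i * expR (- l * mean_kept G v p (K i) s + l ^+ 2 * B).
pose T i := w i * expR (- l * mean_kept G v p (K i) (x :: s)
                        + l ^+ 2 * \sum_(y <- x :: s) influence G v p y).
(* The signs turn averaging into an upper bound: some pick [k] for [x] brings the potential to at
   most [\sum_i T i]. *)
have [||k _ le_k] := @exists_ge_average R I [set: I]
    (fun k => - \sum_i (if i == k then yes i else no i)) (- \sum_i T i).
- by rewrite -card_gt0 cardsT ltnW.
- rewrite cardsT sumrN mulrN lerN2.
  under eq_bigl do rewrite inE.
  rewrite exchange_big /= mulr_sumr; apply: ler_sum => i _.
  rewrite (bigD1 i) //= eqxx (eq_bigr (fun=> no i)); last first.
    by move=> k; rewrite eq_sym => /negbTE ->.
  rewrite sumr_const cardC1 -[no i *+ _]mulr_natl.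
  have -> : #|I|.-1%:R = #|I|%:R * (1 - p) :> R.
    by rewrite mulrBr divff ?gt_eqF// mulr1 -subn1 natrB// ltnW.
  have -> : yes i = #|I|%:R * (p * yes i) by rewrite mulrA divff ?mul1r ?gt_eqF.
  rewrite -mulrA -mulrDr ler_pM2l//.
  have := mean_kept_exp_step p01 v01 (K i) x us' pD p2 l01.
  move/(ler_wpM2l (mulr_ge0 (w0 i) (expR_ge0 (l ^+ 2 * B)))); congr (_ <= _).
    by rewrite /yes /no !expRD; ring.
  rewrite /T big_cons -/B; move: (influence _ _ _ x) => b.
  by move: (mean_kept _ _ _ _ (x :: s)) => e; rewrite mulrDr !expRD; ring.
rewrite lerN2 in le_k.
(* The pick [k] blocks the neighbours of [x] even when [x] is itself blocked and stays
   uncoloured. *)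
pose K' i := if i == k then Kx i else K i.
pose w' i := if i == k then w i * expR (- l * a i) else w i.
have [|f [pf fK le_f]] := IHs K' w' us'.
  by move=> i; rewrite /w'; case: ifP => // _; rewrite mulr_ge0 ?expR_ge0.
have fx : f x = None.
  by case E: (f x) => [i|//]; have [] := fK _ _ E; rewrite (negbTE xs).
pose f' y := if (y == x) && (x \notin K k) then Some k else f y.
have fNk y : edge G x y -> f y <> Some k.
  move=> xy fy; have [_] := fK _ _ fy.
  by rewrite /K' eqxx /Kx !inE xy orbT.
exists f'; split.
- move=> y z i yz; rewrite /f'.
  case: (boolP (x \notin K k)) => [nK|_]; last first.
    by rewrite !andbF; apply: pf.
  rewrite !andbT; case: (eqVneq y x) yz => [->|_] yz.
    move=> [<-]; case: (eqVneq z x) yz => [->|_]; first by rewrite edge_irr.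
    exact: fNk.
  case: (eqVneq z x) yz => [->|_] yz; last exact: pf yz.
  by move=> fy [ki]; subst i; apply: (fNk y); rewrite // edge_sym.
- move=> y i; rewrite /f'; case: ifP => [/andP [/eqP -> nK] [<-]|_ fy].
    by rewrite mem_head.
  have [ys nKi] := fK _ _ fy; rewrite inE ys orbT; split=> //.
  move: nKi; rewrite /K'; case: ifP => // _.
  by rewrite inE negb_or => /andP [].
apply: le_trans le_k.
apply: (@le_trans _ _
  (\sum_i w' i * expR (- l * \sum_(y | f y == Some i) v y))).
  apply: ler_sum => i _; rewrite /w' le_eqVlt; apply/orP; left; apply/eqP.
  have [->|nik] := eqVneq i k; last first.
    congr (_ * expR (_ * _)); apply: eq_bigl => y; rewrite /f'.
    case: ifP => // /andP [/eqP -> _]; rewrite fx.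
    by apply/eqP => -[ki]; rewrite ki eqxx in nik.
  rewrite -mulrA -expRD -mulrDr; congr (_ * expR (_ * _)); rewrite /a.
  case: (boolP (x \in K k)) => Kx0.
    rewrite add0r; apply: eq_bigl => y; rewrite /f' Kx0 andbF//.
  rewrite (bigD1 x) /=; last by rewrite /f' eqxx Kx0.
  congr (_ + _); apply: eq_bigl => y; rewrite /f' Kx0 andbT.
  by have [->|] := eqVneq y x; rewrite ?fx ?andbF ?andbT.
apply: le_trans le_f _; apply: ler_sum => i _; rewrite /w' /K' -/B.
case: ifP => // _; rewrite /yes -mulrA -expRD.
by rewrite [in leRHS]mulrDr addrA.
Qed.

(** * The constant 1 - 1/e and the balanced partial colouring *)

(** For [q = 1 - n^-1] the mean of the first [n] powers is exactly [1 - q ^+ n], and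
    [q <= expR (- n^-1)]. *)
Lemma geometric_mean_ge_expR (R : realType) (d n : nat) : (d < n)%N ->
  1 - 1 / expR 1 <= geometric_mean (1 - n%:R^-1 : R) d.
Proof.
move=> ltdn; have n0 : (0 < n)%N by apply: leq_ltn_trans ltdn.
have nR0 : n%:R != 0 :> R by rewrite pnatr_eq0 -lt0n.
have p01 : 0 <= (n%:R^-1 : R) <= 1.
  by rewrite invr_ge0 ler0n invf_le1 ?ler1n ?ltr0n.
have q01 : 0 <= (1 - n%:R^-1 : R) <= 1 by lra.
apply: le_trans (geometric_mean_ge q01 ltdn).
set q := 1 - _ in q01 *.
have -> : (\sum_(k < n) q ^+ k) / n%:R = 1 - q ^+ n.
  by have := subrX1 q n; rewrite {2}/q addrAC subrr sub0r mulNr mulrC; lra.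
rewrite lerD2l lerN2 div1r -expRN.
have -> : - 1 = n%:R * - n%:R^-1 :> R by rewrite mulrN divff.
rewrite expRM_natl lerXn2r ?nnegrE ?expR_ge0//; first by case/andP: q01.
exact: expR_ge1Dx.
Qed.

(** With unit weights, the term of one colour is at most the whole potential, hence at most [n]
    times the common bound. Taking logarithms and dividing by [l] yields the loss [ln n / l]; the
    loss [2 * l * W] is the total influence. *)
Lemma exists_balanced_partial_coloring (R : realType) (M I : finType)
    (G : simple_graph M) (v : M -> R) (l : R) :
  let n : R := #|I|%:R in
  let W : R := \sum_x v x in
  (1 < #|I|)%N -> (max_degree G < #|I|)%N -> (forall x, 0 <= v x <= 1) ->
  0 < l <= 2^-1 ->
  exists f : M -> option I, proper_coloring G f /\
    forall i, (1 - 1 / expR 1) * W / n - 2 * l * W - ln n / l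
              <= \sum_(y | f y == Some i) v y.
Proof.
move=> n W I1 ltG v01 /andP [l0 l2].
have n0 : 0 < n by rewrite ltr0n ltnW.
have p01 : 0 <= n^-1 <= 1.
  by rewrite invr_ge0 ltW//= invf_le1// ler1n ltnW.
have [p0 p1] := andP p01.
have pD : n^-1 * (max_degree G)%:R <= 1.
  by rewrite mulrC ler_pdivrMr// mul1r ler_nat ltnW.
have l01 : 0 <= l <= 2^-1 by rewrite ltW.
have [s [us sT le_s]] := exists_good_order G v p01 [set: M].
have [|f [pf _ le_f]] := @exists_partial_coloring R M I G v l s
  (fun=> set0) (fun=> 1) I1 ltG v01 l01 us; first by move=> _; exact: ler01.
exists f; split=> // i.
set E := mean_kept _ _ _ _ _ in le_s; set b := \sum_(x <- s) _ in le_f.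
have le_b : b <= 2 * W.
  apply: le_trans (sum_influence p01 v01 pD).
  rewrite /b big_uniq //= le_eqVlt; apply/orP; left; apply/eqP.
  by apply: eq_bigl => x; rewrite sT inE.
have le_E : (1 - 1 / expR 1) * W / n <= E.
  apply: le_trans le_s; rewrite mulrC ler_wpM2l// mulr_sumr.
  rewrite [leRHS](eq_bigl predT) => [|x]; last by rewrite inE.
  apply: ler_sum => x _; have [v0 _] := andP (v01 x).
  rewrite mulrC ler_wpM2l// geometric_mean_ge_expR// setIT.
  exact: leq_ltn_trans (card_neighbors G x) ltG.
set X := \sum_(y | _) v y.
have : expR (- l * X) <= expR (ln n + (- l * E + l ^+ 2 * b)).
  rewrite [leRHS]expRD lnK ?posrE//.
  move: le_f; rewrite sumr_const -[_ *+ _]mulr_natl mul1r; apply: le_trans.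
  rewrite (bigD1 i) //= mul1r lerDl sumr_ge0// => j _.
  by rewrite mul1r expR_ge0.
rewrite ler_expR => le_X.
have l2b : l ^+ 2 * b <= l ^+ 2 * (2 * W) by rewrite ler_wpM2l ?sqr_ge0.
have := ler_wpM2l (ltW l0) le_E; set a := _ / n => le_a.
rewrite -(ler_pM2l l0).
have -> : l * (a - 2 * l * W - ln n / l) = l * a - l ^+ 2 * (2 * W) - ln n.
  by field; rewrite gt_eqF.
by move: le_X l2b le_a; lra.
Qed.

(** * Choice of [l] and the degenerate cases *)

Theorem proposition8 (R : realType) (P : instance R) (v : items P -> R) (c : R)
    (hdeg : (max_degree (conflict P) < #|agents P|)%N)
    (hv01 : forall x, 0 <= v x <= 1)
    (hident : forall (i : agents P) (S : {set items P}),
       valuation i S = \sum_(x in S) v x)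
    (hW : 0 < \sum_(x : items P) v x)
    (hc : Num.sqrt 8 < c) :
  let n : R := #|agents P|%:R in
  let W : R := \sum_(x : items P) v x in
  exists (alpha : R) (A : {ffun agents P -> {set items P}}),
    1 - 1 / expR 1 - c * n * Num.sqrt (ln n / W) <= alpha /\
    approx_proportional alpha A.
Proof.
move=> n W.
have I0 : (0 < #|agents P|)%N by apply: leq_ltn_trans hdeg.
have n0 : 0 < n by rewrite ltr0n.
set r := Num.sqrt _; set a := _ - _ - _.
(* Completing a partial colouring only adds items to bundles, so bounds on the partial bundles
   suffice. *)
have extend (f : items P -> option (agents P)) :
    proper_coloring (conflict P) f ->
    (forall i, a * W / n <= \sum_(y | f y == Some i) v y) ->
    exists (alpha : R) (A : {ffun agents P -> {set items P}}),
      a <= alpha /\ approx_proportional alpha A.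
  move=> pf le_f.
  have [h [hf hp]] := proper_coloring_extend hdeg pf.
  exists a, [ffun i => [set x | h x == i]]; split=> //; split; first split.
  - split=> [i j ij|].
      rewrite !ffunE -setI_eq0; apply/eqP/setP => x; rewrite !inE.
      by apply: contraNF ij => /andP [/eqP <- /eqP <-].
    apply/setP => x; rewrite inE; apply/bigcupP; exists (h x) => //.
    by rewrite ffunE inE.
  - move=> i x y; rewrite !ffunE !inE => /eqP hx /eqP hy.
    by apply/negP => /hp; rewrite hx hy eqxx.
  - move=> i; rewrite !hident ffunE.
    rewrite (eq_bigl predT) => [|x]; last by rewrite inE.
    apply: le_trans (le_f i) _.
    rewrite [leRHS](bigID (fun y => f y == Some i)) /=.
    rewrite [X in _ <= X + _](eq_bigl (fun y => f y == Some i)); last first.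
      move=> y; rewrite inE andbC; case: eqP => //= fy.
      by rewrite (hf _ _ fy) eqxx.
    by rewrite lerDl sumr_ge0// => y _; have /andP [] := hv01 y.
have e1 : 0 <= (1 / expR 1 : R) <= 1.
  rewrite div1r -expRN ?expR_ge0/=.
  by rewrite -[leRHS]expR0 ler_expR; lra.
have c0 : 0 < c by apply: le_lt_trans hc; rewrite sqrtr_ge0.
have r0 : 0 <= r by rewrite sqrtr_ge0.
have [a0|a0] := leP a 0.
  apply: (extend (fun=> None)) => // i.
  rewrite big_pred0 // -mulrA mulr_le0_ge0// divr_ge0 ?ltW//.
have cnr1 : c * n * r < 1 by rewrite /a in a0; lra.
(* For one agent [ln n = 0] would force [l = 0]; but then the graph has no edges and this agent
   takes everything. *)
have [nI|I1] := leqP #|agents P| 1.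
  have I1 : #|agents P| = 1%N by apply/eqP; rewrite eqn_leq nI.
  have /card_gt0P [i0 _] := I0.
  apply: (extend (fun=> Some i0)) => [x y i xy _ _|i].
    have := card_neighbors (conflict P) x.
    move: hdeg; rewrite I1 ltnS leqn0 => /eqP ->.
    by rewrite leqn0 cards_eq0 => /eqP/setP/(_ y); rewrite !inE xy.
  have -> : i = i0 by apply: (fintype_le1P _); rewrite I1.
  rewrite (eq_bigl predT) => [|y]; last by rewrite eqxx.
  have cnr0 : 0 <= c * n * r by rewrite mulr_ge0 ?mulr_ge0 ?(ltW n0) ?(ltW c0).
  have a1 : a <= 1 by rewrite /a; lra.
  have n1 : n = 1 by rewrite /n I1.
  by rewrite n1 divr1 -/W ler_piMl// ltW.
have rW : ln n = r ^+ 2 * W.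
  by rewrite sqr_sqrtr ?divfK ?gt_eqF// divr_ge0 ?ltW// ln_gt0// ltr1n.
have r1 : 0 < r by rewrite sqrtr_gt0 divr_gt0// ln_gt0// ltr1n.
have c8 : 8 <= c ^+ 2.
  rewrite -[leLHS](@sqr_sqrtr R) ?ler0n// lerXn2r ?nnegrE ?sqrtr_ge0 ?ltW//.
have n2 : 2 <= n by rewrite ler_nat.
have cr0 : 0 < c * r by rewrite mulr_gt0.
(* From [c * n * r < 1] and [2 <= n]; it keeps [l] in the admissible range. *)
have cr : c * r <= 2^-1 by nra.
(* With [l = c * r / 4] the loss [2 * l * W] is half of [c * r * W]; the other loss [4 * r * W / c]
   fits into the second half because [8 <= c ^+ 2]. *)
have l01 : 0 < c * r / 4 <= 2^-1 by lra.
have [f [pf le_f]] := exists_balanced_partial_coloring I1 hdeg hv01 l01.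
apply: (extend f) => // i; apply: le_trans (le_f i).
rewrite -/n -/W.
have -> : a * W / n = (1 - 1 / expR 1) * W / n - c * r * W.
  by rewrite /a; field; rewrite ?gt_eqF// expR_gt0.
rewrite -[leRHS]addrA lerD2l -opprD lerN2.
have -> : ln n / (c * r / 4) = 4 * r * W / c.
  by rewrite rW; field; rewrite !gt_eqF.
have -> : c * r * W = c * r * W / 2 + (c ^+ 2 / 2) * (r * W / c).
  by field; rewrite gt_eqF.
rewrite lerD//; first by lra.
have -> : 4 * r * W / c = 4 * (r * W / c) by rewrite !mulrA.
by rewrite ler_wpM2r ?divr_ge0 ?mulr_ge0 ?(ltW c0) ?(ltW hW)//; lra.
Qed.
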